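(* Let $b\ge 2$ and $k\ge 1$ be integers, and let $X$ be a Pareto random variable with minimum value $x_{\mathrm m}>0$ and shape parameter $s>0$. Put $\rho=\{\log_b x_{\mathrm m}\}$ and $\xi=\rho+k-1$, and let $A_{(k)}=\lfloor b^{\{\log_b X\}+k-1}\rfloor$ be the $k$-th integer significand of $X$. Then for every $a\in\{b^{k-1},\ldots,b^k-1\}$, $$\Pr(A_{(k)}=a)=\frac{b^{s(\xi-1)}}{1-b^{-s}}\big(a^{-s}-(a+1)^{-s}\big)+u\big(a+1-b^{\xi}\big)\big(1-b^{s\xi}(a+1)^{-s}\big)-u\big(a-b^{\xi}\big)\big(1-b^{s\xi}a^{-s}\big).$$
   Context: A Pareto random variable with minimum value $x_{\mathrm m}$ and shape parameter $s$ has probability density function $f_X(x)=s\,x_{\mathrm m}^s\,x^{-(s+1)}$ for $x\ge x_{\mathrm m}$ (and $0$ otherwise). $\{z\}=z-\lfloor z\rfloor$ is the fractional part. $u$ is the unit-step function: $u(z)=1$ if $z\ge 0$ and $u(z)=0$ otherwise. The $k$-th integer significand is the integer whose base-$b$ digits are the $k$ most significant $b$-ary digits of $X$. *)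

(* Defs.v *)
From HB Require Import structures.
From mathcomp Require Import all_boot all_order all_algebra.
From mathcomp Require Import all_classical all_reals all_analysis.

Set Implicit Arguments.
Unset Strict Implicit.
Unset Printing Implicit Defensive.

Import Order.TTheory GRing.Theory Num.Theory.
Import numFieldNormedType.Exports.

Local Open Scope classical_set_scope.
Local Open Scope ring_scope.

Definition logb {R : realType} (b : nat) (x : R) : R := ln x / ln b%:R.

Definition fracpart {R : realType} (z : R) : R := z - (Num.floor z)%:~R.

Definition unit_step {R : realType} (z : R) : R := if 0 <= z then 1 else 0.

Definition pareto_pdf {R : realType} (xm s : R) : R -> R :=
  (fun x => s * xm `^ s * x `^ (- (s + 1))) \_ `[xm, +oo[.

Definition is_pareto {d : measure_display} {T : measurableType d}
    {R : realType} (P : probability T R) (X : {RV P >-> R}) (xm s : R) : Prop :=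
  forall B : set R, measurable B ->
    distribution P X B =
      (\int[lebesgue_measure]_(x in B) (pareto_pdf xm s x)%:E)%E.

(* For [x > 0] and [1 <= k], the base-[b] digits of this integer are the [k]
   most significant ones of [x].  At [x <= 0] the value is a convention
   ([ln x = 0] there), irrelevant for almost surely positive variables. *)
Definition int_significand {R : realType} (b k : nat) (x : R) : int :=
  Num.floor (b%:R `^ (fracpart (logb b x) + k%:R - 1)).

(* Main.v *)
Require Import Defs.
From HB Require Import structures.
From mathcomp Require Import all_boot all_order all_algebra.
From mathcomp Require Import all_classical all_reals all_analysis.
From mathcomp Require Import ring lra.

Set Implicit Arguments.
Unset Strict Implicit.
Unset Printing Implicit Defensive.

Import Order.TTheory GRing.Theory Num.Theory.
Import numFieldNormedType.Exports.

Local Open Scope classical_set_scope.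
Local Open Scope ring_scope.

(** The reals whose [k] leading digits are those of [a] form one interval per
    decade (a decade being an interval between consecutive powers of [b]): for
    [x > 0], writing [j] for the integer part of [log_b x], the significand of
    [x] is [a] iff [x] lies in [[a q, (a + 1) q[] with [q = b ^ (j + 1 - k)]
    ([int_significand_decade]).  These intervals are pairwise disjoint, so the
    probability is a sum over decades of differences of the survival function
    of [X], which is [1] below [xm] and [(xm / y) ^ s] above
    ([pareto_survivalE]).

    Let [J] be the decade of [xm], so that [xm = b ^ (J + rho)].  Decades below
    [J] carry no mass.  In decade [J + i] the survival function at [c q]
    depends only on [c] and [i] ([pareto_survival_scaled]), because
    [xm / (c q) = b ^ (xi - i) / c].
    - For [i = 0] the point [xm] itself lies in the decade, below, inside or
      above its interval; the two unit steps record on which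
      side of [xm] its endpoints are.
    - For [i >= 1] the whole decade is above [xm], so that the survival function
      is a pure power and the masses form a geometric sequence of ratio
      [b ^ (- s)].  Their sum is the first term of the formula. *)

(** * Real powers and geometric series *)

Lemma gt0_powRD {R : realType} (B x y : R) : 0 < B ->
  B `^ (x + y) = B `^ x * B `^ y.
Proof. by move=> B0; rewrite powRD// (gt_eqF B0) implybT. Qed.

Lemma powRN_cvgy0 {R : realType} (s : R) : 0 < s ->
  x `^ (- s) @[x --> +oo] --> 0.
Proof.
move=> s_gt0.
apply: (@cvg_trans _ (expR (- (s * ln x)) @[x --> +oo])).
  apply: near_eq_cvg; near=> x.
  by rewrite /powR gt_eqF ?mulNr.
apply: (@cvg_comp _ _ _ (fun x : R => s * ln x) (fun z : R => expR (- z)) _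
  (pinfty_nbhs R)); last exact: cvgr_expR.
apply: gt0_cvgMry => //.
apply/cvgryPge => A; near=> x.
by rewrite -[A]expRK ler_ln ?posrE ?expR_gt0//.
Unshelve. all: by end_near. Qed.

Lemma nneseries_geometric_tail {R : realType} (t : nat -> R) (c z : R) :
  `|z| < 1 -> (forall i, t i.+1 = c * z ^+ i) ->
  (\sum_(0 <= i <oo) (t i)%:E)%E = (t 0%N + c / (1 - z))%:E.
Proof.
move=> z1 tE; apply/cvg_lim => //.
rewrite (_ : (fun n => _) = EFin \o series t); last first.
  by apply/funext => n; rewrite /= sumEFin.
apply: cvg_EFin; first exact: nearW.
rewrite -cvg_shiftS.
rewrite (_ : (fun n => _) =
             fun n => t 0%N + series (geometric c z) n); last first.
  apply/funext => n; rewrite /series/= big_nat_recl//; congr (_ + _).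
  by apply: eq_bigr => i _; rewrite tE.
by apply: cvgD; [exact: cvg_cst|exact: cvg_geometric_series].
Qed.

(** * Survival function of a Pareto variable *)

Definition pareto_survival {R : realType} (xm s y : R) : R :=
  1 - unit_step (y - xm) * (1 - (xm / y) `^ s).

(** Scaling [xm] and [y] by the common factor [B ^ q] leaves the survival
    function unchanged, which makes the probabilities independent of the decade
    in which [xm] lies. *)
Lemma pareto_survival_scaled {R : realType} (B c x q i s : R) :
  0 < B -> 0 < c ->
  pareto_survival (B `^ (x + q)) s (c * B `^ (i + q)) =
  1 - unit_step (c - B `^ (x - i)) * (1 - B `^ (s * (x - i)) * c `^ (- s)).
Proof.
move=> B0 c0.
have iq0 : 0 < B `^ (i + q) by exact: powR_gt0.
have -> : B `^ (x + q) = B `^ (x - i) * B `^ (i + q).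
  by rewrite -gt0_powRD//; congr (_ `^ _); ring.
rewrite /pareto_survival /unit_step !subr_ge0 ler_pM2r//.
have -> : B `^ (x - i) * B `^ (i + q) / (c * B `^ (i + q)) = B `^ (x - i) / c.
  by field; rewrite !gt_eqF.
rewrite powRM ?powR_ge0 ?invr_ge0 ?(ltW c0)// -powRrM [_ * s]mulrC.
by rewrite -[c^-1]powR_inv1 ?(ltW c0)// -powRrM mulN1r.
Qed.

Section Pareto.
Context {d : measure_display} {T : measurableType d} {R : realType}.
Variables (P : probability T R) (X : {RV P >-> R}) (xm s : R).
Hypotheses (xm_gt0 : 0 < xm) (s_gt0 : 0 < s) (X_pareto : is_pareto X xm s).

(** The density vanishes below [xm]; two Borel sets that agree above [xm] thus
    have the same probability. *)
Lemma pareto_support (E : set R) : measurable E ->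
  distribution P X E = distribution P X (E `&` `[xm, +oo[).
Proof.
move=> mE; have mI : measurable (E `&` `[xm, +oo[) by exact: measurableI.
rewrite !X_pareto// integral_mkcondr; apply: eq_integral => x _.
rewrite !patchE; case: ifPn => // /negbTE h.
by rewrite /pareto_pdf patchE h.
Qed.

(** The function [- xm ^ s * x ^ (- s)] is a primitive of the density on
    [[xm, +oo[] and vanishes at infinity. *)
Lemma pareto_tail (y : R) : xm <= y ->
  distribution P X `[y, +oo[ = ((xm / y) `^ s)%:E.
Proof.
move=> xmy; have y0 : 0 < y by exact: lt_le_trans xmy.
pose f x := s * xm `^ s * x `^ (- (s + 1)).
have dF (x : R) : 0 < x ->
    is_derive x 1 (fun x => - (xm `^ s * x `^ (- s))) (f x).
  move=> x0; have h := is_derive1_powR (- s) x0.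
  apply: is_derive_eq; rewrite /f /GRing.scale/= opprD; ring.
have cf (x : R) : 0 < x -> {for x, continuous f}.
  move=> x0; apply: differentiable_continuous; apply/derivable1_diffP.
  have h := is_derive1_powR (- (s + 1)) x0.
  by apply: ex_derive.
rewrite X_pareto//.
under eq_integral => x.
  rewrite inE/= in_itv/= andbT => yx.
  rewrite /pareto_pdf patchE mem_set/=; last first.
    by rewrite in_itv/= andbT (le_trans xmy).
  over.
rewrite (@ge0_continuous_FTC2y _ f (fun x => - (xm `^ s * x `^ (- s))) y 0).
- by rewrite -EFinN opprK add0r powRM ?invr_ge0 ?(ltW xm_gt0) ?(ltW y0)//
    -[y^-1]powR_inv1 ?(ltW y0)// -powRrM mulN1r.
- by move=> x _; rewrite /f !mulr_ge0 ?powR_ge0 ?ltW.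
- apply: continuous_in_subspaceT => x; rewrite inE/= in_itv/= andbT => yx.
  exact: (cf x (lt_le_trans y0 yx)).
- rewrite -[0]oppr0; apply: cvgN; rewrite -[0](mulr0 (xm `^ s)).
  by apply: cvgMl_tmp; exact: (powRN_cvgy0 s_gt0).
- by move=> x yx; case: (dF x (lt_trans y0 yx)).
- have [/derivable1_diffP/differentiable_continuous h _] := dF y y0.
  by apply: cvg_at_right_filter; exact: h.
- move=> x; rewrite in_itv/= andbT => yx.
  by rewrite derive1E; case: (dF x (lt_trans y0 yx)).
Qed.

Lemma pareto_survivalE (y : R) :
  distribution P X `[y, +oo[ = (pareto_survival xm s y)%:E.
Proof.
rewrite /pareto_survival /unit_step subr_ge0.
have [xmy|yxm] := leP xm y; first by rewrite pareto_tail// mul1r subKr.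
rewrite mul0r subr0 pareto_support// setIidr; last first.
  by apply: subset_itvr; rewrite bnd_simp ltW.
by rewrite pareto_tail// divff ?gt_eqF// powR1.
Qed.

Lemma pareto_itv (l r : R) : l <= r ->
  distribution P X `[l, r[ =
  (pareto_survival xm s l - pareto_survival xm s r)%:E.
Proof.
move=> lr; rewrite EFinB -!pareto_survivalE.
have -> : `[l, r[%classic = `[l, +oo[ `\` `[r, +oo[.
  apply/seteqP; split => x /=; rewrite !in_itv/= !andbT.
    by move=> /andP[-> xr]; split => //; rewrite leNgt xr.
  by case=> -> /negP; rewrite -ltNge.
rewrite measureD//; last by rewrite ltey_eq fin_num_measure.
rewrite setIidr//; apply: subset_itvr; rewrite bnd_simp//.
Qed.

End Pareto.

(** * The numbers with a given integer significand *)

Section Significand.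
Variables (R : realType) (b k a : nat).
Hypotheses (b_ge2 : (2 <= b)%N) (k_ge1 : (1 <= k)%N).
Hypothesis (a_range : (b ^ (k - 1) <= a <= b ^ k - 1)%N).

Let B : R := b%:R.

Let B_gt0 : 0 < B.
Proof. by rewrite ltr0n (ltn_trans _ b_ge2). Qed.

Let B_gt1 : 1 < B.
Proof. by rewrite ltr1n. Qed.

Let B_neq0 : B != 0.
Proof. by rewrite gt_eqF. Qed.

Lemma powR_logb (x : R) : 0 < x -> B `^ logb b x = x.
Proof.
move=> x0; rewrite /powR (negbTE B_neq0) /logb divfK ?lnK//.
by rewrite gt_eqF// ln_gt0.
Qed.

Lemma floor_logb (j : int) (x : R) :
  B `^ j%:~R <= x < B `^ (j + 1)%:~R -> Num.floor (logb b x) = j.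
Proof.
move=> /andP[jx xj]; have x0 : 0 < x by rewrite (lt_le_trans _ jx)// powR_gt0.
have lnB : 0 < ln B by rewrite ln_gt0.
apply: floor_def; rewrite /logb ler_pdivlMr// ltr_pdivrMr// -!ln_powR.
by rewrite ler_ln ?ltr_ln ?posrE ?powR_gt0// jx.
Qed.

(** The reals of the decade [[b ^ j, b ^ (j + 1)[] whose [k] leading digits are
    those of [a]. *)
Definition block (j : int) : set R :=
  `[a%:R * B `^ (j%:~R + 1 - k%:R), (a%:R + 1) * B `^ (j%:~R + 1 - k%:R)[.

Lemma significand_lb : B `^ (k%:R - 1) <= a%:R.
Proof.
rewrite (_ : k%:R - 1 = (k - 1)%:R :> R); last by rewrite natrB.
rewrite powR_mulrn ?(ltW B_gt0)// -natrX ler_nat.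
by case/andP: a_range.
Qed.

Lemma significand_ub : a%:R + 1 <= B `^ k%:R.
Proof.
rewrite powR_mulrn ?(ltW B_gt0)// -natrX natr1 ler_nat.
case/andP: a_range => _ h; rewrite (leq_ltn_trans h)// subn1 prednK//.
by rewrite expn_gt0 (ltn_trans _ b_ge2).
Qed.

Lemma significand_gt0 : 0 < a%:R :> R.
Proof. exact: lt_le_trans (powR_gt0 _ B_gt0) significand_lb. Qed.

(** The digit bounds on [a] are exactly what keeps each block in its decade. *)
Lemma block_sub (j : int) : block j `<=` `[B `^ j%:~R, B `^ (j + 1)%:~R[.
Proof.
move=> x; rewrite /block/= !in_itv/= => /andP[lx xr]; apply/andP; split.
  apply: le_trans lx.
  have -> : B `^ j%:~R = B `^ (k%:R - 1) * B `^ (j%:~R + 1 - k%:R).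
    by rewrite -gt0_powRD//; congr (_ `^ _); ring.
  by rewrite ler_pM2r ?powR_gt0// significand_lb.
apply: (lt_le_trans xr).
have -> : B `^ (j + 1)%:~R = B `^ k%:R * B `^ (j%:~R + 1 - k%:R).
  by rewrite -gt0_powRD// intrD; congr (_ `^ _); ring.
by rewrite ler_pM2r ?powR_gt0// significand_ub.
Qed.

Lemma int_significand_decade (j : int) (x : R) :
  B `^ j%:~R <= x < B `^ (j + 1)%:~R ->
  int_significand b k x = a%:Z <-> block j x.
Proof.
move=> jx; have x0 : 0 < x.
  by case/andP: jx => jx _; rewrite (lt_le_trans _ jx)// powR_gt0.
have p0 : 0 < B `^ (j%:~R + 1 - k%:R) by exact: powR_gt0.
rewrite /int_significand /fracpart (floor_logb jx) -/B.
rewrite (_ : logb b x - _ + _ - _ = logb b x - (j%:~R + 1 - k%:R));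
  last by ring.
rewrite gt0_powRD// powR_logb// powRN /block/= in_itv/=.
rewrite -ler_pdivlMr// -ltr_pdivrMr//.
rewrite (rwP eqP) floor_eq intrD.
by split.
Qed.

Lemma int_significandP (x : R) : 0 < x ->
  int_significand b k x = a%:Z <-> exists j : int, block j x.
Proof.
move=> x0; split=> [sx|[j jx]]; last first.
  apply/(@int_significand_decade j) => //.
  by have := block_sub jx; rewrite /= in_itv.
exists (Num.floor (logb b x)); apply/int_significand_decade => //.
rewrite -{2 3}(powR_logb x0) ler_powR ?(ltW B_gt1)//=; last exact: floor_le.
by rewrite /powR (negbTE B_neq0) ltr_expR ltr_pM2r ?ln_gt0// floorD1_gt.
Qed.

Lemma measurable_block (j : int) : measurable (block j).
Proof. exact: measurable_itv. Qed.

(** On nonpositive reals the significand is constant, since [ln] is [0] there;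
    on positive reals the level set is a countable union of intervals. *)
Lemma measurable_int_significand :
  measurable [set x : R | int_significand b k x = a%:Z].
Proof.
set E := [set x | _].
have -> : E = (E `&` `]-oo, 0]) `|` \bigcup_j block j.
  apply/seteqP; split => x.
    move=> Ex; have [x0|x0] := leP x 0.
      by left; split; rewrite //= in_itv.
    by right; have [j jx] := (int_significandP x0).1 Ex; exists j.
  case=> [[]//|[j _ jx]]; apply/int_significandP; last by exists j.
  have := block_sub jx; rewrite /= in_itv/= => /andP[+ _].
  by apply: lt_le_trans; exact: powR_gt0.
apply: measurableU; last first.
  apply: countable_bigcupT_measurable => [|j]; first by [].
  exact: measurable_block.
have sx0 (x : R) : x <= 0 ->
    int_significand b k x = int_significand b k (0 : R).
  by move=> x0; rewrite /int_significand /logb (ln0 x0) (ln0 (lexx 0)).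
have [E0|E0] := eqVneq (int_significand b k (0 : R)) a%:Z.
  rewrite setIidr// => x /=; rewrite in_itv/= => x0.
  by rewrite /E/= sx0.
rewrite (_ : _ `&` _ = set0)//; apply/seteqP; split => x //=.
by rewrite in_itv/= /E/= => -[+ x0]; rewrite sx0//; exact/eqP.
Qed.

Lemma trivIset_block : trivIset setT block.
Proof.
move=> i j _ _ [x [/block_sub + /block_sub]]; rewrite /= !in_itv/=.
by move=> /floor_logb <- /floor_logb <-.
Qed.

(** Decades below that of [xm] do not meet [[xm, +oo[], so the decades above can
    be enumerated by [nat], starting at that of [xm]. *)
Lemma int_significand_bigcup (xm : R) : 0 < xm ->
  [set x | int_significand b k x = a%:Z] `&` `[xm, +oo[ =
  (\bigcup_(i in [set: nat]) block (Num.floor (logb b xm) + i%:Z))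
    `&` `[xm, +oo[.
Proof.
move=> xm0; set J := Num.floor _.
apply/seteqP; split => x [] Ex /=; rewrite in_itv/= andbT => xmx; split => //.
  have x0 : 0 < x by exact: lt_le_trans xmx.
  have [j jx] := (int_significandP x0).1 Ex.
  have Jj : J <= j.
    have := block_sub jx; rewrite /= in_itv/= => /floor_logb <-.
    apply: le_floor; rewrite ler_pM2r ?invr_gt0 ?ln_gt0//.
    by rewrite ler_ln ?posrE.
  exists `|j - J|%N => //.
  by rewrite gez0_abs ?subr_ge0// [J + _]addrC subrK.
have x0 : 0 < x by exact: lt_le_trans xmx.
by case: Ex => i _ jx; apply/(int_significandP x0); exists (J + i%:Z).
Qed.

End Significand.

(** * The distribution of the significand *)

Theorem mainTheorem7 (R : realType) (d : measure_display)
    (T : measurableType d) (P : probability T R) (X : {RV P >-> R})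
    (b k : nat) (xm s : R)
    (hb : (2 <= b)%N) (hk : (1 <= k)%N) (hxm : 0 < xm) (hs : 0 < s)
    (hX : is_pareto X xm s) (a : nat)
    (ha : (b ^ (k - 1) <= a <= b ^ k - 1)%N) :
  let rho : R := fracpart (logb b xm) in
  let xi : R := rho + k%:R - 1 in
  let B : R := b%:R in
  P [set w | int_significand b k (X w) = a%:Z] =
  (B `^ (s * (xi - 1)) / (1 - B `^ (- s))
     * (a%:R `^ (- s) - (a%:R + 1) `^ (- s))
   + unit_step (a%:R + 1 - B `^ xi)
     * (1 - B `^ (s * xi) * (a%:R + 1) `^ (- s))
   - unit_step (a%:R - B `^ xi)
     * (1 - B `^ (s * xi) * a%:R `^ (- s)))%:E.
Proof.
move=> rho xi B.
have B1 : 1 < B by rewrite ltr1n.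
have B0 : 0 < B by exact: lt_trans ltr01 B1.
pose J := Num.floor (logb b xm).
pose q : R := J%:~R + 1 - k%:R.
have xmE : xm = B `^ (xi + q).
  rewrite -[LHS](powR_logb hb hxm); congr (_ `^ _).
  by rewrite /q /xi /rho /fracpart -/J; ring.
have lb := significand_lb R hb hk ha.
have a0 := significand_gt0 R hb hk ha.
have rho1 : rho < 1.
  by rewrite ltrBlDr addrC; have := floorD1_gt (logb b xm); rewrite intrD.
pose S := pareto_survival xm s.
pose l (c : R) (i : nat) := c * B `^ ((J + i%:Z)%:~R + 1 - k%:R).
have SE (c : R) i : 0 < c ->
    S (l c i) = 1 - unit_step (c - B `^ (xi - i%:R))
                  * (1 - B `^ (s * (xi - i%:R)) * c `^ (- s)).
  move=> c0; rewrite -(pareto_survival_scaled xi q i%:R s B0 c0) -xmE.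
  rewrite /S /l /q intrD -pmulrn.
  by congr (pareto_survival _ _ (_ * _ `^ _)); ring.
(* As [rho < 1], the step is [1] in every decade after that of [xm]. *)
have SES (c : R) i : a%:R <= c ->
    S (l c i.+1) = B `^ (s * (xi - 1)) * B `^ (- s) ^+ i * c `^ (- s).
  move=> ac; rewrite SE; last exact: lt_le_trans ac.
  rewrite /unit_step subr_ge0 ifT; last first.
    apply: le_trans ac; apply: le_trans lb; apply: ler_powR; first exact: ltW.
    by rewrite /xi -natr1; have := ler0n R i; lra.
  rewrite mul1r subKr -powR_mulrn ?powR_ge0// -powRrM -gt0_powRD//.
  by congr (B `^ _ * _); rewrite -natr1; ring.
transitivity (distribution P X [set x | int_significand b k x = a%:Z]) => //.
rewrite (pareto_support hX (measurable_int_significand hb hk ha)).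
rewrite (int_significand_bigcup hb hk ha hxm) -/J.
pose D i : set R := block b k a (J + i%:Z).
have mD i : measurable (D i) by exact: measurable_block.
have muD i : distribution P X (D i) = (S (l a%:R i) - S (l (a%:R + 1) i))%:E.
  by rewrite (pareto_itv hxm hs hX)// ler_pM2r ?powR_gt0// lerDl.
rewrite -(pareto_support hX); last exact: bigcupT_measurable.
rewrite measure_semi_bigcup//; last 2 first.
- apply/trivIsetP => i j _ _ ij.
  have /trivIsetP := trivIset_block hb hk ha (R := R); apply => //.
  by rewrite (inj_eq (addrI _)) eqz_nat.
- exact: bigcupT_measurable.
rewrite (eq_eseriesr (fun i _ => muD i)).
rewrite (@nneseries_geometric_tail _ _
  (B `^ (s * (xi - 1)) * (a%:R `^ (- s) - (a%:R + 1) `^ (- s))) (B `^ (- s))).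
- rewrite !SE ?ltr_wpDr// !subr0; congr (_%:E).
  by ring.
- rewrite ger0_norm ?powR_ge0// powRN invf_lt1 ?powR_gt0//.
  by rewrite -[1](powRr0 B) /powR (gt_eqF B0) ltr_expR ltr_pM2r ?ln_gt0.
- by move=> i; rewrite !SES ?lerDl//; ring.
Qed.
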